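(* Let $N\ge2$ and let $u^0,\dots,u^N$ be smooth real functions of $(x,j)\in\mathbb R\times\mathbb Z$. Put $\gamma^n=e^{u^n-u^{n+1}_1}$ for $0\le n\le N-1$. Consider the equations for nowhere vanishing functions $A,B$ of $(x,j)$ with $AB=-1$: $$A_1=A,\quad A_x+\left(u^0_x+u^1_{1,x}+e^{u^0-u^1_1}\right)A=0,\qquad B_1=B,\quad B_x=\left(u^0_x+u^1_x+e^{u^1-u^2_1}\right)B, \qquad( * )$$ together with the linear equations for the vectors $\phi=(\phi^1,\dots,\phi^N)^T$, $\rho=(\rho^1,\dots,\rho^N)^T$: $$\begin{pmatrix} D\phi \\ D^{-1}\rho \end{pmatrix}=\begin{pmatrix} u_{11} & u_{12} \\ 0 & u_{22} \end{pmatrix}\begin{pmatrix} \phi \\ \rho \end{pmatrix},\qquad \begin{pmatrix} \phi_x \\ \rho_x \end{pmatrix}=\begin{pmatrix} v_{11} & 0 \\ {v_{21}} & v_{22} \end{pmatrix}\begin{pmatrix} \phi \\ \rho \end{pmatrix},\qquad( ** )$$ where all blocks are $N\times N$ and the nonzero entries are as follows: - $u_{11}$ has all diagonal entries $1$ and $(u_{11})_{n+1,n}=\gamma^n$ for $1\le n\le N-1$; - $u_{12}$ has the single nonzero entry $(u_{12})_{1,1}=A\gamma^0$; - $u_{22}$ has all diagonal entries $1$ and $(u_{22})_{n,n+1}=\gamma^n$ for $1\le n\le N-1$; - $(v_{11})_{n,n}=-u^n_x$ for $1\le n\le N$ and $(v_{11})_{n,n+1}=1$ for $1\le n\le N-1$;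 - $v_{21}$ has the single nonzero entry $(v_{21})_{1,1}=-B$; - $(v_{22})_{1,1}=\gamma^0+u^1_{1,x}$, $(v_{22})_{n,n}=u^n_{1,x}$ for $2\le n\le N$, and $(v_{22})_{n+1,n}=-1$ for $1\le n\le N-1$. Then the compatibility conditions of $( * )$, $( ** )$ yield the system $$\begin{aligned} u^0_x-u^0_{1,x}&=e^{u^1_1-u^2_2}-e^{u^0-u^1_1},\\ {u^n_x}-u^n_{1,x}&=e^{u^{n-1}-u^n_1}-e^{u^n-u^{n+1}_1},\qquad 1\le n\le N-1,\\ {u^N_x}-u^N_{1,x}&=e^{u^{N-1}-u^N_1},\end{aligned}$$ i.e. $( * )$, $( ** )$ are compatible if and only if $u^0,\dots,u^N$ satisfy this system for all $(x,j)$.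
   Context: For a function $f=f(x,j)$, $j\in\mathbb Z$, write $f_k=f(x,j+k)$, $f_x=\partial_xf$, $f_{k,x}=\partial_x f(x,j+k)$; $D$ is the shift $Df=f_1$. Compatibility: $( * )$, $( ** )$ are called compatible if there exist smooth nowhere vanishing $A,B$ with $AB=-1$ satisfying $( * )$ for all $(x,j)$ and such that, with these $A,B$, the linear equations $( ** )$ satisfy $D_xD\phi=DD_x\phi$ and $D_xD\rho=DD_x\rho$ identically in $\phi,\rho$ (regarded as arbitrary independent vectors). Here $D\rho$ is obtained from the shifted relation $\rho=(Du_{22})\,D\rho$, so that $D\rho=(Du_{22})^{-1}\rho$. Equivalently, writing $\Psi=(\phi,\rho)^T$, $D\Psi=M\Psi$ and $\Psi_x=V\Psi$, the condition is $M_x=(DV)M-MV$ for all $(x,j)$. *)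

(* Defs.v *)
From HB Require Import structures.
From mathcomp Require Import all_boot all_order all_algebra.
From mathcomp Require Import all_classical all_reals all_analysis.

Set Implicit Arguments.
Unset Strict Implicit.
Unset Printing Implicit Defensive.

Import Order.TTheory GRing.Theory Num.Theory.
Import numFieldNormedType.Exports.

Local Open Scope ring_scope.

(* A function f(x,j) on R x Z, scalar or matrix valued, has type
   R -> int -> T. *)

Definition sh (R : realType) (T : Type) (f : R -> int -> T) : R -> int -> T :=
  fun x j => f x (j + 1).

Definition dx (R : realType) (f : R -> int -> R) : R -> int -> R :=
  fun x j => derive1 (f ^~ j) x.

Definition dxmx (R : realType) (m n : nat) (P : R -> int -> 'M[R]_(m, n)) :
    R -> int -> 'M[R]_(m, n) :=
  fun x j => \matrix_(i, k) dx (fun y l => P y l i k) x j.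

(* C^oo in x for every fixed j. *)
Definition smooth (R : realType) (f : R -> int -> R) : Prop :=
  forall (j : int) (k : nat) (x : R), derivable (derive1n k (f ^~ j)) x 1.

(* The unknowns u^0, ..., u^N are the values at 0, ..., N of a family indexed
   by nat; no value beyond N is ever used below. *)
Definition gam (R : realType) (u : nat -> R -> int -> R) (n : nat) :
    R -> int -> R :=
  fun x j => expR (u n x j - sh (u n.+1) x j).

Definition Aeqs (R : realType) (u : nat -> R -> int -> R)
    (A : R -> int -> R) : Prop :=
  forall x j,
    sh A x j = A x j /\
    dx A x j + (dx (u 0%N) x j + dx (sh (u 1%N)) x j
                + expR (u 0%N x j - sh (u 1%N) x j)) * A x j = 0.

Definition Beqs (R : realType) (u : nat -> R -> int -> R)
    (B : R -> int -> R) : Prop :=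
  forall x j,
    sh B x j = B x j /\
    dx B x j = (dx (u 0%N) x j + dx (u 1%N) x j
                + expR (u 1%N x j - sh (u 2%N) x j)) * B x j.

(* Rows and columns are numbered from 0: the entry (i, k) of the matrices
   below is the entry (i+1, k+1) in the usual numbering. *)

Definition u11 (R : realType) (N : nat) (u : nat -> R -> int -> R) :
    R -> int -> 'M[R]_N :=
  fun x j => \matrix_(i, k)
    if i == k then 1
    else if (i == k.+1 :> nat) then gam u k.+1 x j
    else 0.

Definition u12 (R : realType) (N : nat) (u : nat -> R -> int -> R)
    (A : R -> int -> R) : R -> int -> 'M[R]_N :=
  fun x j => \matrix_(i, k)
    if (i == 0%N :> nat) && (k == 0%N :> nat) then A x j * gam u 0 x j
    else 0.

Definition u22 (R : realType) (N : nat) (u : nat -> R -> int -> R) :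
    R -> int -> 'M[R]_N :=
  fun x j => \matrix_(i, k)
    if i == k then 1
    else if (k == i.+1 :> nat) then gam u i.+1 x j
    else 0.

Definition v11 (R : realType) (N : nat) (u : nat -> R -> int -> R) :
    R -> int -> 'M[R]_N :=
  fun x j => \matrix_(i, k)
    if i == k then - dx (u i.+1) x j
    else if (k == i.+1 :> nat) then 1
    else 0.

Definition v21 (R : realType) (N : nat) (B : R -> int -> R) :
    R -> int -> 'M[R]_N :=
  fun x j => \matrix_(i, k)
    if (i == 0%N :> nat) && (k == 0%N :> nat) then - B x j else 0.

Definition v22 (R : realType) (N : nat) (u : nat -> R -> int -> R) :
    R -> int -> 'M[R]_N :=
  fun x j => \matrix_(i, k)
    if i == k then
      if (i == 0%N :> nat) then gam u 0 x j + dx (sh (u 1%N)) x j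
      else dx (sh (u i.+1)) x j
    else if (i == k.+1 :> nat) then - 1
    else 0.

(* D Psi = M Psi for Psi = (phi, rho)^T.  The second block row is the relation
   D^-1 rho = u22 rho, shifted to rho = (D u22) (D rho) and solved for D rho;
   D u22 is unitriangular, hence invertible. *)
Definition Mmx (R : realType) (N : nat) (u : nat -> R -> int -> R)
    (A : R -> int -> R) : R -> int -> 'M[R]_(N + N) :=
  fun x j => block_mx (u11 N u x j) (u12 N u A x j)
                      0             (invmx (sh (u22 N u) x j)).

(* Psi_x = V Psi *)
Definition Vmx (R : realType) (N : nat) (u : nat -> R -> int -> R)
    (B : R -> int -> R) : R -> int -> 'M[R]_(N + N) :=
  fun x j => block_mx (v11 N u x j) 0
                      (v21 N B x j) (v22 N u x j).

(* A vector expression depending linearly on (phi, rho) is represented by its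
   coefficient matrix P, the expression being P Psi.  By virtue of the linear
   equations, D (P Psi) = (D P) M Psi and
   D_x (P Psi) = P_x Psi + P Psi_x = (P_x + P V) Psi. *)
Definition linD (R : realType) (m n : nat) (M : R -> int -> 'M[R]_n)
    (P : R -> int -> 'M[R]_(m, n)) : R -> int -> 'M[R]_(m, n) :=
  fun x j => sh P x j *m M x j.

Definition linDx (R : realType) (m n : nat) (V : R -> int -> 'M[R]_n)
    (P : R -> int -> 'M[R]_(m, n)) : R -> int -> 'M[R]_(m, n) :=
  fun x j => dxmx P x j + P x j *m V x j.

Definition phiE (R : realType) (N : nat) : R -> int -> 'M[R]_(N, N + N) :=
  fun _ _ => row_mx 1%:M 0.

Definition rhoE (R : realType) (N : nat) : R -> int -> 'M[R]_(N, N + N) :=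
  fun _ _ => row_mx 0 1%:M.

(* D_x D phi = D D_x phi and D_x D rho = D D_x rho, identically in the
   independent vectors phi and rho. *)
Definition commuting_flows (R : realType) (N : nat)
    (M V : R -> int -> 'M[R]_(N + N)) : Prop :=
  forall (x : R) (j : int) (phi rho : 'cV[R]_N),
    linDx V (linD M (@phiE R N)) x j *m col_mx phi rho
      = linD M (linDx V (@phiE R N)) x j *m col_mx phi rho /\
    linDx V (linD M (@rhoE R N)) x j *m col_mx phi rho
      = linD M (linDx V (@rhoE R N)) x j *m col_mx phi rho.

Definition compatible (R : realType) (N : nat) (u : nat -> R -> int -> R) :
    Prop :=
  exists A B : R -> int -> R,
    [/\ smooth A /\ smooth B,
        (forall x j, A x j != 0) /\ (forall x j, B x j != 0),
        forall x j, A x j * B x j = - 1,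
        Aeqs u A /\ Beqs u B &
        commuting_flows (Mmx N u A) (Vmx N u B)].

Definition toda_system (R : realType) (N : nat) (u : nat -> R -> int -> R) :
    Prop :=
  forall x j,
    [/\ dx (u 0%N) x j - dx (sh (u 0%N)) x j
          = expR (sh (u 1%N) x j - sh (sh (u 2%N)) x j)
            - expR (u 0%N x j - sh (u 1%N) x j),
        forall n, (1 <= n <= N.-1)%N ->
          dx (u n) x j - dx (sh (u n)) x j
            = expR (u n.-1 x j - sh (u n) x j)
              - expR (u n x j - sh (u n.+1) x j) &
        dx (u N) x j - dx (sh (u N)) x j
          = expR (u N.-1 x j - sh (u N) x j)].

(* Main.v *)
(* Write A_x = - g A and B_x = h B for the equations on A and B.  The compatibility
   of the linear equations, M_x = (DV) M - M V, splits into N x N blocks.  The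
   (phi, phi) block reduces to its diagonal, and since A B = -1 its diagonal entries
   are exactly the equations for u^1, ..., u^N.  The off-diagonal blocks hold by the
   equations on A and B alone, and the (rho, rho) block, cleared of the inverse of
   D u22, is the shift by D of the (phi, phi) block.  Given the equation for u^1, the
   one for u^0 is equivalent to D h = h, which follows from D B = B.  Conversely the
   equation for u^1 says g = h, and the one for u^0 then gives D g = g, so that
   A = exp (- int g) and B = - 1 / A are as required. *)

Require Import Defs.
From mathcomp Require Import all_boot all_order all_algebra.
From mathcomp Require Import all_classical all_reals all_analysis.
From mathcomp Require Import ring lra zify.

Set Implicit Arguments.
Unset Strict Implicit.
Unset Printing Implicit Defensive.

Import Order.TTheory GRing.Theory Num.Theory.
Import numFieldNormedType.Exports.

Local Open Scope ring_scope.

(** * Calculus of smooth functions *)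

Section Calculus.
Local Open Scope classical_set_scope.

Variable R : realType.
Implicit Types f g h : R -> R.

Lemma is_derive1P f (x d : R) : is_derive x 1 f d <-> derivable f x 1 /\ f^`() x = d.
Proof.
split=> [H|[df <-]]; last by apply: DeriveDef => //; rewrite derive1E.
by split; [exact: ex_derive|rewrite derive1E derive_val].
Qed.

(* The FTC of the library integrates from a fixed lower bound a < x; F is
   independent of a, which can then be chosen below any given point. *)
Lemma continuous_antiderivative f : continuous f ->
  exists F : R -> R, forall x, is_derive x (1 : R) F (f x).
Proof.
move=> cf.
have fint a b : (@lebesgue_measure R).-integrable `[a, b] (EFin \o f).
  apply: continuous_compact_integrable; first exact: segment_compact.
  exact: continuous_subspaceT.
pose G a x := (\int[lebesgue_measure]_(t in `[a, x]) f t)%R.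
pose F x := if 0 <= x then (\int[lebesgue_measure]_(t in `]0, x]) f t)%R
            else - (\int[lebesgue_measure]_(t in `]x, 0]) f t)%R.
(* Additivity of the integral over adjacent intervals, in the cases 0 <= x and x < 0. *)
have FG a x : a < x -> a < 0 -> F x = G a x - G a 0.
  move=> ax a0; rewrite /F /G; case: ifPn => [x0|].
    by rewrite -(@Rintegral_itvB _ f (BLeft a) (BRight x) 0) // bnd_simp // ltW.
  rewrite -ltNge => /ltW x0.
  by rewrite -(@Rintegral_itvB _ f (BLeft a) (BRight 0) x) ?opprB // bnd_simp // ltW.
(* This [a] lies strictly below both [x0] and 0, so [FG] applies on a whole neighbourhood of [x0],
   where [F] and [G a] differ by a constant. *)
exists F => x0; pose a := Num.min x0 0 - 1.
have [ax0 a0] : a < x0 /\ a < 0.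
  by rewrite /a; split; rewrite ltrBlDr gt_min ?ltrDl ?add0r ltr01 ?orbT.
have [dG G'] : derivable (G a) x0 1 /\ (G a)^`() x0 = f x0.
  apply: (@continuous_FTC1_closed _ f a x0 (x0 + 1)) => //.
  - by rewrite ltrDl.
  - exact: cf.
have H : is_derive x0 (1 : R) (fun x => G a x - G a 0) (f x0).
  have H : is_derive x0 (1 : R) (G a) (f x0) by apply/is_derive1P.
  have := is_deriveB H (is_derive_cst (G a 0) x0 (1:R)).
  by rewrite subr0.
have E : {near x0, (fun x => G a x - G a 0) =1 F}.
  near=> x; rewrite (FG a) //; near: x; exact: lt_nbhsr.
apply: DeriveDef.
  by apply: near_eq_derivable E _; exact: ex_derive.
by rewrite -(near_eq_derive _ E) derive_val.
Unshelve. all: by end_near. Qed.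

(** * Smooth functions of one variable: sums, products, linear equations *)

Definition smooth1 f := forall k x, derivable (f^`(k)) x 1.

(* Off by one: Ck n f says that f is n+1 times differentiable. *)
Definition Ck n f := forall k, (k <= n)%N -> forall x, derivable (f^`(k)) x 1.

Lemma Ck0 f : Ck 0 f <-> (forall x, derivable f x 1).
Proof.
split=> [H|H k]; first exact: (H 0%N).
by rewrite leqn0 => /eqP ->.
Qed.

Lemma CkS n f : Ck n.+1 f <-> (forall x, derivable f x 1) /\ Ck n (f^`()).
Proof.
split=> [H|[H1 H2] [|k] lek x]; [split| |].
- exact: (H 0%N).
- by move=> k lek; rewrite -derive1Sn; exact: H.
- exact: H1.
- by rewrite derive1Sn; exact: H2.
Qed.

Lemma CkW n f : Ck n.+1 f -> Ck n f.
Proof. by move=> H k lek; apply: H; exact: leqW. Qed.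

Lemma is_derive_mul f g (x a b : R) : is_derive x 1 f a -> is_derive x 1 g b ->
  is_derive x 1 (fun y => f y * g y) (a * g x + f x * b).
Proof.
move=> Hf Hg; rewrite addrC [a * _]mulrC; exact: is_deriveM Hf Hg.
Qed.

Lemma is_derive_add f g (x a b : R) : is_derive x 1 f a -> is_derive x 1 g b ->
  is_derive x 1 (fun y => f y + g y) (a + b).
Proof. by move=> Hf Hg; exact: is_deriveD Hf Hg. Qed.

Lemma CkD n f g : Ck n f -> Ck n g -> Ck n (fun x => f x + g x).
Proof.
elim: n f g => [|n IH] f g.
  move=> /Ck0 df /Ck0 dg; apply/Ck0 => x; exact: derivableD (df x) (dg x).
move=> /CkS[df Cf] /CkS[dg Cg].
have D x : is_derive (x : R) (1 : R) (fun x => f x + g x) (derive1 f x + derive1 g x).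
  by apply: is_derive_add; apply/is_derive1P.
apply/CkS; split=> [x|]; first by have /is_derive1P[] := D x.
suff -> : derive1 (fun x => f x + g x) = (fun x => derive1 f x + derive1 g x) by exact: IH.
by apply/funext => x; have /is_derive1P[] := D x.
Qed.

Lemma CkM n f g : Ck n f -> Ck n g -> Ck n (fun x => f x * g x).
Proof.
elim: n f g => [|n IH] f g.
  move=> /Ck0 df /Ck0 dg; apply/Ck0 => x; exact: derivableM (df x) (dg x).
move=> Cf1 Cg1; have /CkS[df Cf] := Cf1; have /CkS[dg Cg] := Cg1.
have D x : is_derive (x : R) (1 : R) (fun x => f x * g x) (derive1 f x * g x + f x * derive1 g x).
  by apply: is_derive_mul; apply/is_derive1P.
apply/CkS; split=> [x|]; first by have /is_derive1P[] := D x.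
suff -> : derive1 (fun x => f x * g x) = (fun x => derive1 f x * g x + f x * derive1 g x).
  (* In f' g + f g' the derivatives lie one class lower than f and g, so the undifferentiated
     factors are first weakened by [CkW]. *)
  exact: (CkD (IH _ _ Cf (CkW Cg1)) (IH _ _ (CkW Cf1) Cg)).
by apply/funext => x; have /is_derive1P[] := D x.
Qed.

Lemma smooth1P f : smooth1 f <-> forall n, Ck n f.
Proof.
by split=> [H n k _ x|H k x]; [exact: H|exact: (H k)].
Qed.

Lemma smooth1D f g : smooth1 f -> smooth1 g -> smooth1 (fun x => f x + g x).
Proof. by rewrite !smooth1P => Cf Cg n; exact: CkD. Qed.

Lemma CkN n f : Ck n f -> Ck n (fun x => - f x).
Proof.
elim: n f => [|n IH] f; first by move=> /Ck0 df; apply/Ck0 => x; exact: derivableN (df x).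
move=> /CkS[df Cf].
have D x : is_derive (x : R) (1 : R) (fun x => - f x) (- derive1 f x).
  by apply: is_deriveN; apply/is_derive1P.
apply/CkS; split=> [x|]; first by have /is_derive1P[] := D x.
suff -> : derive1 (fun x => - f x) = (fun x => - derive1 f x) by exact: IH.
by apply/funext => x; have /is_derive1P[] := D x.
Qed.

Lemma smooth1N f : smooth1 f -> smooth1 (fun x => - f x).
Proof. by rewrite !smooth1P => Cf n; exact: CkN. Qed.

Lemma smooth1_derive f : smooth1 f -> smooth1 (f^`()).
Proof. by move=> sf k x; rewrite -derive1Sn. Qed.

(* By bootstrap: if f is C^n, so is f' = h f. *)
Lemma smooth1_linear_ode f h : smooth1 h ->
  (forall x, is_derive x (1 : R) f (h x * f x)) -> smooth1 f.
Proof.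
rewrite !smooth1P => sh f'; have df x : derivable f x 1 by exact: ex_derive.
elim=> [|n IH]; first exact/Ck0.
apply/CkS; split=> //; suff -> : derive1 f = (fun x => h x * f x) by exact: (CkM (sh n) IH).
by apply/funext => x; have /is_derive1P[] := f' x.
Qed.

Lemma is_derive_exp f (x d : R) : is_derive x 1 f d ->
  is_derive x (1 : R) (fun y => expR (f y)) (d * expR (f x)).
Proof. by move=> H; rewrite mulrC; exact: is_derive1_comp. Qed.

(** The function e^f solves y' = f' y, a linear equation with smooth coefficient. *)
Lemma smooth1_exp f : smooth1 f -> smooth1 (fun x => expR (f x)).
Proof.
move=> sf; apply: (smooth1_linear_ode (smooth1_derive sf)) => x.
by apply: is_derive_exp; apply/is_derive1P; split=> //; exact: (sf 0%N).
Qed.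

Lemma smooth1_continuous f : smooth1 f -> continuous f.
Proof.
by move=> sf x; apply: differentiable_continuous; apply/derivable1_diffP; exact: (sf 0%N).
Qed.

(** * Derivability of determinants and adjugates *)

(** By the Leibniz expansion a determinant is a finite sum of finite products of entries. *)
Lemma derivable_det n (P : R -> 'M[R]_n) x :
  (forall i k, derivable (fun y => P y i k) x 1) ->
  derivable (fun y => \det (P y)) x 1.
Proof.
move=> dP.
have dprod (I : eqType) (s : seq I) (F : I -> R -> R) :
    (forall i, derivable (F i) x 1) -> derivable (fun y => \prod_(i <- s) F i y) x 1.
  move=> dF; elim: s => [|i s IH].
    have -> : (fun y => \prod_(l <- [::]) F l y) = cst 1.
      by apply/funext => y; exact: big_nil.
    exact: derivable_cst.
  have -> : (fun y => \prod_(l <- i :: s) F l y) = (fun y => F i y * \prod_(l <- s) F l y).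
    by apply/funext => y; exact: big_cons.
  exact: derivableM (dF i) IH.
have dsum (I : eqType) (s : seq I) (F : I -> R -> R) :
    (forall i, derivable (F i) x 1) -> derivable (fun y => \sum_(i <- s) F i y) x 1.
  move=> dF; elim: s => [|i s IH].
    have -> : (fun y => \sum_(l <- [::]) F l y) = cst 0.
      by apply/funext => y; exact: big_nil.
    exact: derivable_cst.
  have -> : (fun y => \sum_(l <- i :: s) F l y) = (fun y => F i y + \sum_(l <- s) F l y).
    by apply/funext => y; exact: big_cons.
  exact: derivableD (dF i) IH.
apply: dsum => s; apply: derivableM; first exact: derivable_cst.
exact: dprod.
Qed.

(** Up to sign, each entry of the adjugate is a minor. This serves to differentiate inverses of
    matrices of determinant 1. *)
Lemma derivable_adj n (P : R -> 'M[R]_n) x :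
  (forall i k, derivable (fun y => P y i k) x 1) ->
  forall i k, derivable (fun y => (\adj (P y))%R i k) x 1.
Proof.
move=> dP i k; under eq_fun do rewrite mxE.
apply: derivableM; first exact: derivable_cst.
apply: derivable_det => a b; under eq_fun do rewrite !mxE; exact: dP.
Qed.

End Calculus.

(** * Bidiagonal matrices *)

Section LinearAlgebra.
Variable R : realType.

Lemma mulmx_cV_inj m n (P Q : 'M[R]_(m, n)) :
  (forall v : 'cV[R]_n, P *m v = Q *m v) -> P = Q.
Proof.
move=> H; apply/matrixP => i k.
by have := congr1 (fun v : 'cV_m => v i 0) (H (delta_mx k 0)); rewrite -!colE !mxE.
Qed.

Lemma dx_cst (c : R) (x : R) (j : int) : dx (fun _ _ => c) x j = 0.
Proof. exact: derive1_cst. Qed.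

(** The constant matrices [phiE] and [rhoE] select the upper and lower halves of the rows, and
    [phi], [rho] together run through all column vectors. The two vector identities thus amount to
    one matrix equation, the zero-curvature condition. *)
Lemma commuting_flowsP N (M V : R -> int -> 'M[R]_(N + N)) :
  commuting_flows M V <->
  forall x j, dxmx M x j + M x j *m V x j = V x (j + 1) *m M x j.
Proof.
have upper (P : R -> int -> 'M[R]_(N + N)) y l x j : @phiE R N y l *m P x j = usubmx (P x j).
  by rewrite -{1}[P x j]vsubmxK mul_row_col mul1mx mul0mx addr0.
have lower (P : R -> int -> 'M[R]_(N + N)) y l x j : @rhoE R N y l *m P x j = dsubmx (P x j).
  by rewrite -{1}[P x j]vsubmxK mul_row_col mul1mx mul0mx add0r.
have phiDxD x j : linDx V (linD M (@phiE R N)) x j = usubmx (dxmx M x j + M x j *m V x j).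
  rewrite /linDx /linD /sh upper mul_usub_mx linearD /=; congr (_ + _).
  apply/matrixP => i k; rewrite !mxE; congr (derive1 _ x).
  by apply/funext => y; rewrite upper mxE.
have phiDDx x j : linD M (linDx V (@phiE R N)) x j = usubmx (V x (j + 1) *m M x j).
  suff E : dxmx (@phiE R N) x (j + 1) = 0 by rewrite /linD /sh /linDx E add0r upper mul_usub_mx.
  by apply/matrixP => i k; rewrite [RHS]mxE mxE; exact: dx_cst.
have rhoDxD x j : linDx V (linD M (@rhoE R N)) x j = dsubmx (dxmx M x j + M x j *m V x j).
  rewrite /linDx /linD /sh lower mul_dsub_mx linearD /=; congr (_ + _).
  apply/matrixP => i k; rewrite !mxE; congr (derive1 _ x).
  by apply/funext => y; rewrite lower mxE.
have rhoDDx x j : linD M (linDx V (@rhoE R N)) x j = dsubmx (V x (j + 1) *m M x j).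
  suff E : dxmx (@rhoE R N) x (j + 1) = 0 by rewrite /linD /sh /linDx E add0r lower mul_dsub_mx.
  by apply/matrixP => i k; rewrite [RHS]mxE mxE; exact: dx_cst.
split=> [H x j|H x j phi rho]; last by rewrite phiDxD phiDDx rhoDxD rhoDDx H.
rewrite -[LHS]vsubmxK -[RHS]vsubmxK -phiDxD -phiDDx -rhoDxD -rhoDDx.
by congr col_mx; apply: mulmx_cV_inj => v; rewrite -(vsubmxK v); case: (H x j (usubmx v) (dsubmx v)).
Qed.

(** * Products of bidiagonal and corner matrices *)

Lemma sum_ord_pred1 n (k : nat) (F : nat -> R) :
  \sum_(l < n) (if l == k :> nat then F l else 0) = if (k < n)%N then F k else 0.
Proof.
rewrite -big_mkcond /=; case: ltnP => kn.
  by rewrite (big_pred1 (Ordinal kn)) // => l; rewrite -val_eqE.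
by rewrite big_pred0 // => l; apply/negbTE; rewrite neq_ltn (leq_trans (ltn_ord l) kn).
Qed.

(** Entries are functions of natural numbers, so that the neighbours of an index need no bound
    proofs. An off-diagonal entry is always indexed by the smaller of its row and column. *)
Definition updiag (d e : nat -> R) (i k : nat) : R :=
  if i == k then d i else if k == i.+1 then e i else 0.

Definition lodiag (d e : nat -> R) (i k : nat) : R :=
  if i == k then d i else if i == k.+1 then e k else 0.

Definition tridiag (d e f : nat -> R) (i k : nat) : R :=
  if i == k then d i else if k == i.+1 then e i else if i == k.+1 then f k else 0.

Definition corner (a : R) (i k : nat) : R :=
  if (i == 0%N) && (k == 0%N) then a else 0.

Definition natmx n (f : nat -> nat -> R) : 'M[R]_n := \matrix_(i, k) f i k.

Lemma eq_natmx n f g : (forall i k, (i < n)%N -> (k < n)%N -> f i k = g i k) ->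
  natmx n f = natmx n g.
Proof. by move=> H; apply/matrixP => i k; rewrite !mxE H. Qed.

Lemma sum_updiag n d e i (F : nat -> R) : (i < n)%N ->
  \sum_(l < n) updiag d e i l * F l
  = d i * F i + (if (i.+1 < n)%N then e i * F i.+1 else 0).
Proof.
move=> ltin; rewrite -(sum_ord_pred1 n i.+1 (fun l => e i * F l)).
(* The vacuous condition brings the diagonal term into the shape of [sum_ord_pred1], so that both
   terms become sums over the row. *)
have -> : d i * F i = if (i < n)%N then d i * F i else 0 by rewrite ltin.
rewrite -(sum_ord_pred1 n i (fun l => d i * F l)) -big_split; apply: eq_bigr => l _ /=.
rewrite /updiag (eq_sym i); have [->|li] := eqVneq (l : nat) i.
  by rewrite (ltn_eqF (ltnSn i)) addr0.
by case: eqP; rewrite add0r ?mul0r.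
Qed.

Lemma sum_lodiag n d e i (F : nat -> R) : (i < n)%N ->
  \sum_(l < n) lodiag d e i l * F l
  = d i * F i + (if (0 < i)%N then e i.-1 * F i.-1 else 0).
Proof.
move=> ltin.
have -> : (if (0 < i)%N then e i.-1 * F i.-1 else 0)
    = \sum_(l < n) if i == l.+1 then e l * F l else 0.
  case: i ltin => [|i] ltin /=; first by rewrite big1.
  have := sum_ord_pred1 n i (fun l => e l * F l); rewrite ltnW // => <-.
  by apply: eq_bigr => l _; rewrite eqSS eq_sym.
have -> : d i * F i = if (i < n)%N then d i * F i else 0 by rewrite ltin.
rewrite -(sum_ord_pred1 n i (fun l => d i * F l)) -big_split; apply: eq_bigr => l _ /=.
rewrite /lodiag (eq_sym i l); have [->|li] := eqVneq (l : nat) i.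
  by rewrite (ltn_eqF (ltnSn i)) addr0.
by case: eqP; rewrite add0r ?mul0r.
Qed.

Lemma sum_corner n a i (F : nat -> R) : (0 < n)%N ->
  \sum_(l < n) corner a i l * F l = if i == 0%N then a * F 0%N else 0.
Proof.
move=> n0; have := sum_ord_pred1 n 0 (fun l => a * F l); rewrite n0 /corner => H.
case: (i == 0%N) => /=; last by rewrite big1 // => l _; rewrite mul0r.
by rewrite -H; apply: eq_bigr => l _; case: eqP; rewrite ?mul0r.
Qed.

Lemma mul_natmx n f g : natmx n f *m natmx n g =
  natmx n (fun i k => \sum_(l < n) f i l * g l k).
Proof. by apply/matrixP => i k; rewrite !mxE; apply: eq_bigr => l _; rewrite !mxE. Qed.

Ltac diag_cases :=
  repeat (case: eqP => ? || case: ifP => ?); try (exfalso; lia); subst => //=; try ring.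

(** The order of the factors decides where the diagonal is truncated: here the off-diagonal
    contribution is missing in the first row, for the opposite order in the last row. This asymmetry
    yields the boundary equations of the Toda system. *)
Lemma mul_lodiag_updiag n d e d' e' :
  natmx n (lodiag d e) *m natmx n (updiag d' e') =
  natmx n (tridiag (fun i => d i * d' i + (if (0 < i)%N then e i.-1 * e' i.-1 else 0))
                   (fun i => d i * e' i) (fun k => e k * d' k)).
Proof.
rewrite mul_natmx; apply: eq_natmx => i k lti _.
rewrite (sum_lodiag d e (fun l => updiag d' e' l k) lti) /updiag /tridiag.
by diag_cases.
Qed.

Lemma mul_updiag_lodiag n d e d' e' :
  natmx n (updiag d e) *m natmx n (lodiag d' e') =
  natmx n (tridiag (fun i => d i * d' i + (if (i.+1 < n)%N then e i * e' i else 0))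
                   (fun i => e i * d' i.+1) (fun k => d k.+1 * e' k)).
Proof.
rewrite mul_natmx; apply: eq_natmx => i k lti ltk.
rewrite (sum_updiag d e (fun l => lodiag d' e' l k) lti) /lodiag /tridiag.
by diag_cases.
Qed.

Lemma mul_updiag_corner n d e a : (0 < n)%N ->
  natmx n (updiag d e) *m natmx n (corner a) = natmx n (corner (d 0%N * a)).
Proof.
move=> n0; rewrite mul_natmx; apply: eq_natmx => i k lti _.
rewrite (sum_updiag d e (fun l => corner a l k) lti) /corner /=.
by case: i {lti} => [|i] /=; case: (k == 0%N); rewrite /= ?mulr0 ?if_same ?addr0.
Qed.

Lemma mul_corner_lodiag n d e a : (0 < n)%N ->
  natmx n (corner a) *m natmx n (lodiag d e) = natmx n (corner (a * d 0%N)).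
Proof.
move=> n0; rewrite mul_natmx; apply: eq_natmx => i k _ _.
rewrite (sum_corner a i (fun l => lodiag d e l k) n0) /corner /lodiag /= (eq_sym 0%N k).
by case: i => [|i] //=; case: (k == 0%N) => //=; rewrite mulr0.
Qed.

(** Only the first row survives. It is written in bidiagonal form so that it can be compared
    entrywise with the tridiagonal products. *)
Lemma mul_corner_updiag n d e a : (0 < n)%N ->
  natmx n (corner a) *m natmx n (updiag d e) =
  natmx n (updiag (fun i => if i == 0%N then a * d 0%N else 0)
                  (fun i => if i == 0%N then a * e 0%N else 0)).
Proof.
move=> n0; rewrite mul_natmx; apply: eq_natmx => i k _ _.
rewrite (sum_corner a i (fun l => updiag d e l k) n0) /updiag.
by diag_cases.
Qed.

Lemma mul_corner n a b : (0 < n)%N ->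
  natmx n (corner a) *m natmx n (corner b) = natmx n (corner (a * b)).
Proof.
move=> n0; rewrite mul_natmx; apply: eq_natmx => i k _ _.
rewrite (sum_corner a i (fun l => corner b l k) n0) /corner.
by case: i => [|i] //=; case: ifP; rewrite ?mulr0.
Qed.

Lemma det_updiag n d e : (forall i, d i = 1) -> \det (natmx n (updiag d e)) = 1.
Proof.
move=> d1; rewrite -det_tr det_trig.
  by rewrite big1 // => i _; rewrite !mxE /updiag eqxx d1.
apply/is_trig_mxP => i k ik; rewrite !mxE /updiag.
by rewrite gtn_eqF // ltn_eqF //; exact: leqW.
Qed.

Lemma dxmx_block m1 m2 n1 n2 (a : R -> int -> 'M[R]_(m1, n1)) (b : R -> int -> 'M[R]_(m1, n2))
    (c : R -> int -> 'M[R]_(m2, n1)) (d : R -> int -> 'M[R]_(m2, n2)) x j :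
  dxmx (fun y l => block_mx (a y l) (b y l) (c y l) (d y l)) x j =
  block_mx (dxmx a x j) (dxmx b x j) (dxmx c x j) (dxmx d x j).
Proof.
rewrite -[LHS]submxK; congr block_mx; apply/matrixP => i k; rewrite !mxE; congr (derive1 _ x);
 apply/funext => y; by rewrite ?block_mxEul ?block_mxEur ?block_mxEdl ?block_mxEdr.
Qed.

Lemma shift_invariant (f : int -> R) : (forall j, f (j + 1) = f j) -> forall j, f j = f 0.
Proof.
move=> H; elim/int_ind => [//|n IH|n IH]; first by rewrite -addn1 PoszD H.
by rewrite -IH -(H (- n.+1%:Z)) -addn1 PoszD opprD addrNK.
Qed.

End LinearAlgebra.

(** * Derivatives of matrix products and inverses *)

Section InverseDerivative.
Variable R : realType.

Lemma dxmx_mul m n p (P : R -> int -> 'M[R]_(m, n)) (Q : R -> int -> 'M[R]_(n, p)) x j :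
  (forall i k, derivable (fun y => P y j i k) x 1) ->
  (forall i k, derivable (fun y => Q y j i k) x 1) ->
  dxmx (fun y l => P y l *m Q y l) x j = dxmx P x j *m Q x j + P x j *m dxmx Q x j.
Proof.
move=> dP dQ; apply/matrixP => i k; rewrite !mxE -big_split /=.
have D l : is_derive x 1 (fun y => P y j i l * Q y j l k)
    (dxmx P x j i l * Q x j l k + P x j i l * dxmx Q x j l k).
  by rewrite !mxE; apply: is_derive_mul; apply/is_derive1P.
have S (s : seq 'I_n) : is_derive x (1 : R) (fun y => \sum_(l <- s) P y j i l * Q y j l k)
    (\sum_(l <- s) (dxmx P x j i l * Q x j l k + P x j i l * dxmx Q x j l k)).
  elim: s => [|l s IH].
    rewrite big_nil; have -> : (fun y => \sum_(l <- [::]) P y j i l * Q y j l k) = cst 0.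
      by apply/funext => y; exact: big_nil.
    exact: is_derive_cst.
  rewrite big_cons.
  have -> : (fun y => \sum_(l <- l :: s) P y j i l * Q y j l k) =
      (fun y => P y j i l * Q y j l k + \sum_(l <- s) P y j i l * Q y j l k).
    by apply/funext => y; exact: big_cons.
  exact: is_derive_add (D l) IH.
have /is_derive1P[_ /= <-] := S (index_enum 'I_n).
by rewrite /dx; congr (derive1 _ x); apply/funext => y; rewrite mxE.
Qed.

(** Differentiate c c^-1 = 1. That c^-1 is derivable at all is seen beforehand: determinant 1 makes
    it the adjugate of c. *)
Lemma dxmx_inv n (c : R -> int -> 'M[R]_n) x j :
  (forall y, \det (c y j) = 1) ->
  (forall i k, derivable (fun y => c y j i k) x 1) ->
  dxmx (fun y l => invmx (c y l)) x j = - (invmx (c x j) *m dxmx c x j *m invmx (c x j)).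
Proof.
move=> det1 dc.
have uc y : c y j \in unitmx by rewrite unitmxE det1 unitr1.
have invE y : invmx (c y j) = \adj (c y j) by rewrite /invmx uc det1 invr1 scale1r.
have dinv i k : derivable (fun y => invmx (c y j) i k) x 1.
  have -> : (fun y => invmx (c y j) i k) = (fun y => (\adj (c y j))%R i k).
    by apply/funext => y; rewrite invE.
  exact: derivable_adj.
have := @dxmx_mul _ _ _ c (fun y l => invmx (c y l)) x j dc dinv.
have -> : dxmx (fun y l => c y l *m invmx (c y l)) x j = 0.
  apply/matrixP => i k; rewrite mxE [RHS]mxE /dx.
  have -> : (fun y => (c y j *m invmx (c y j)) i k) = cst ((1%:M : 'M[R]_n) i k).
    by apply/funext => y; rewrite mulmxV.
  exact: derive1_cst.
move=> /esym/eqP; rewrite addrC addr_eq0 => /eqP E.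
by rewrite -mulmxA -mulmxN -E mulKmx.
Qed.

End InverseDerivative.

(** * Blocks of the compatibility condition *)

Section Compatibility.
Variables (R : realType) (N : nat) (u : nat -> R -> int -> R).
Hypothesis hN : (2 <= N)%N.
Hypothesis hu : forall n, (n <= N)%N -> smooth (u n).

Let N0 : (0 < N)%N. Proof. exact: leq_trans hN. Qed.

(** * Entries of the coefficient matrices and their derivatives *)

Lemma is_derive_smooth (f : R -> int -> R) x j : smooth f ->
  is_derive x (1 : R) (f ^~ j) (dx f x j).
Proof. by move=> sf; apply/is_derive1P; split=> //; exact: (sf j 0%N). Qed.

Lemma is_derive_gam n x j : (n < N)%N ->
  is_derive x (1 : R) (gam u n ^~ j) ((dx (u n) x j - dx (u n.+1) x (j + 1)) * gam u n x j).
Proof.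
move=> ltn; apply: is_derive_exp.
exact: is_deriveB (is_derive_smooth x j (hu (ltnW ltn))) (is_derive_smooth x (j + 1) (hu ltn)).
Qed.

Lemma dx_gam n x j : (n < N)%N ->
  dx (gam u n) x j = (dx (u n) x j - dx (u n.+1) x (j + 1)) * gam u n x j.
Proof. by move=> ltn; have /is_derive1P[] := is_derive_gam x j ltn. Qed.

Lemma u11E x j : u11 N u x j = @natmx R N (lodiag (fun=> 1) (fun k => gam u k.+1 x j)).
Proof. by apply/matrixP => i k; rewrite !mxE. Qed.

Lemma u12E A x j : u12 N u A x j = @natmx R N (corner (A x j * gam u 0 x j)).
Proof. by apply/matrixP => i k; rewrite !mxE. Qed.

Lemma u22E x j : u22 N u x j = @natmx R N (updiag (fun=> 1) (fun i => gam u i.+1 x j)).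
Proof. by apply/matrixP => i k; rewrite !mxE. Qed.

Lemma v11E x j : v11 N u x j = @natmx R N (updiag (fun i => - dx (u i.+1) x j) (fun=> 1)).
Proof. by apply/matrixP => i k; rewrite !mxE. Qed.

Lemma v21E B x j : v21 N B x j = @natmx R N (corner (- B x j)).
Proof. by apply/matrixP => i k; rewrite !mxE. Qed.

Lemma v22E x j : v22 N u x j = @natmx R N (lodiag
  (fun i => if i == 0%N then gam u 0 x j + dx (u 1%N) x (j + 1) else dx (u i.+1) x (j + 1))
  (fun=> -1)).
Proof. by apply/matrixP => i k; rewrite !mxE. Qed.

Lemma dxmx_u11 x j : dxmx (u11 N u) x j = @natmx R N (lodiag (fun=> 0)
  (fun k => (dx (u k.+1) x j - dx (u k.+2) x (j + 1)) * gam u k.+1 x j)).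
Proof.
apply/matrixP => i k; rewrite !mxE.
have -> : dx (fun y l => u11 N u y l i k) x j =
    dx (fun y l => lodiag (fun=> 1) (fun k => gam u k.+1 y l) i k) x j.
  by congr (derive1 _ x); apply/funext => y; rewrite u11E mxE.
rewrite /lodiag; case: eqP => [_|_]; first exact: dx_cst.
case: eqP => [ik|_]; last exact: dx_cst.
by rewrite -dx_gam // -ik.
Qed.

Lemma dxmx_u22 x j : dxmx (u22 N u) x j = @natmx R N (updiag (fun=> 0)
  (fun i => (dx (u i.+1) x j - dx (u i.+2) x (j + 1)) * gam u i.+1 x j)).
Proof.
apply/matrixP => i k; rewrite !mxE.
have -> : dx (fun y l => u22 N u y l i k) x j =
    dx (fun y l => updiag (fun=> 1) (fun i => gam u i.+1 y l) i k) x j.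
  by congr (derive1 _ x); apply/funext => y; rewrite u22E mxE.
rewrite /updiag; case: eqP => [_|_]; first exact: dx_cst.
case: eqP => [ki|_]; last exact: dx_cst.
by rewrite -dx_gam // -ki.
Qed.

Lemma derivable_u22 x j i k : derivable (fun y => u22 N u y j i k) x 1.
Proof.
have -> : (fun y => u22 N u y j i k) =
    (fun y => updiag (fun=> 1) (fun i => gam u i.+1 y j) i k).
  by apply/funext => y; rewrite u22E mxE.
rewrite /updiag; case: eqP => [_|_]; first exact: derivable_cst.
case: eqP => [ki|_]; last exact: derivable_cst.
have lti : (i.+1 < N)%N by rewrite -ki.
by have /is_derive1P[] := is_derive_gam x j lti.
Qed.

Lemma dxmx_u12 A x j : smooth A -> dxmx (u12 N u A) x j = @natmx R N (corner
  (dx A x j * gam u 0 x j + A x j * ((dx (u 0%N) x j - dx (u 1%N) x (j + 1)) * gam u 0 x j))).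
Proof.
move=> sA; apply/matrixP => i k; rewrite !mxE.
have -> : dx (fun y l => u12 N u A y l i k) x j =
    dx (fun y l => corner (A y l * gam u 0 y l) i k) x j.
  by congr (derive1 _ x); apply/funext => y; rewrite u12E mxE.
rewrite /corner; case: ifP => _; last exact: dx_cst.
by have /is_derive1P[_] := is_derive_mul (is_derive_smooth x j sA) (is_derive_gam x j N0).
Qed.

(* gam u N is junk: it involves u N.+1. *)
Definition toda_at n x j :=
  dx (u n) x j - dx (u n) x (j + 1) =
  gam u n.-1 x j - (if (n < N)%N then gam u n x j else 0).

(** * The four blocks of the zero-curvature equation *)

Definition phi_block A B x j :=
  dxmx (u11 N u) x j + (u11 N u x j *m v11 N u x j + u12 N u A x j *m v21 N B x j)
  = v11 N u x (j + 1) *m u11 N u x j.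

(** Off the diagonal both sides agree identically: the superdiagonal entries are 1, and on the
    subdiagonal the derivative of gamma^n accounts for the difference. On the diagonal, the term
    gamma^0 that the truncated product leaves out in the first row is supplied by u12 v21 through A
    B = -1. *)
Lemma phi_blockP A B x j : A x j * B x j = - 1 ->
  phi_block A B x j <-> forall n, (1 <= n <= N)%N -> toda_at n x j.
Proof.
move=> AB.
rewrite /phi_block dxmx_u11 u11E !v11E u12E v21E mul_lodiag_updiag mul_updiag_lodiag mul_corner //.
have -> : A x j * gam u 0 x j * (- B x j) = gam u 0 x j.
  by transitivity (- (A x j * B x j) * gam u 0 x j); [ring|rewrite AB; ring].
rewrite /toda_at; split=> [E [|n] // ltn|E].
  (* With rows numbered from 0, the equation of index [n.+1] sits at the diagonal position [n]. *)
  have := congr1 (fun P : 'M[R]_N => P (Ordinal ltn) (Ordinal ltn)) E.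
  rewrite !mxE /= /lodiag /tridiag /corner !eqxx.
  by case: n {E} ltn => [|n] ltn /=; case: ifP => _; lra.
apply/matrixP => i k; rewrite !mxE /= /lodiag /tridiag /corner.
have [<-|ik] := eqVneq (i : nat) k.
  move: (E i.+1 (ltn_ord i)) => /=.
  by case: (i : nat) => [|n] /=; case: ifP => _; lra.
have -> : (i == 0%N :> nat) && (k == 0%N :> nat) = false by lia.
by do 2![case: eqP => ?]; (ring || (exfalso; lia)).
Qed.

(** Only the corner entry is nonzero. Divided by A gamma^0, it is precisely the equation for A_x. *)
Lemma u12_block A x j : smooth A ->
  dx A x j = - (dx (u 0%N) x j + dx (u 1%N) x (j + 1) + gam u 0 x j) * A x j ->
  dxmx (u12 N u A) x j + u12 N u A x j *m v22 N u x j
  = v11 N u x (j + 1) *m u12 N u A x j.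
Proof.
move=> sA Ax; rewrite dxmx_u12 // u12E v22E v11E mul_corner_lodiag // mul_updiag_corner //=.
apply/matrixP => i k; rewrite !mxE /corner; case: ifP => _; last by rewrite addr0.
by rewrite Ax; ring.
Qed.

Lemma u22_unit x j : u22 N u x j \in unitmx.
Proof. by rewrite unitmxE u22E det_updiag ?unitr1. Qed.

(** The first column of D u22 and the first row of u11 are those of the identity, so both factors
    leave a corner matrix unchanged and only D B = B remains. *)
Lemma v21_block B x j : B x (j + 1) = B x j ->
  invmx (u22 N u x (j + 1)) *m v21 N B x j = v21 N B x (j + 1) *m u11 N u x j.
Proof.
move=> B1; rewrite u11E !v21E mul_corner_lodiag // mulr1 B1.
apply: (can_inj (mulKmx (u22_unit x (j + 1)))).
by rewrite mulKVmx ?u22_unit // u22E mul_updiag_corner // mul1r.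
Qed.

(* Multiplying by the unitriangular D u22 on both sides clears the inverses; what
   is left is the shift of the phi block. *)
Lemma rho_block A B x j : A x j * B x (j + 1) = - 1 ->
  (forall n, (1 <= n <= N)%N -> toda_at n x (j + 1)) ->
  dxmx (fun y l => invmx (u22 N u y (l + 1))) x j
    + invmx (u22 N u x (j + 1)) *m v22 N u x j
  = v21 N B x (j + 1) *m u12 N u A x j
    + v22 N u x (j + 1) *m invmx (u22 N u x (j + 1)).
Proof.
move=> AB E; pose c := u22 N u x (j + 1).
have uc : c \in unitmx by exact: u22_unit.
rewrite (@dxmx_inv _ _ (fun y l => u22 N u y (l + 1))); first last.
- by move=> i k; exact: derivable_u22.
- by move=> y; rewrite u22E det_updiag.
have -> : dxmx (fun y l => u22 N u y (l + 1)) x j = dxmx (u22 N u) x (j + 1) by [].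
apply: (can_inj (mulKmx uc)); apply: (can_inj (mulmxK uc)).
rewrite -/c !mulmxDr !mulmxDl mulmxN mulNmx !mulmxA mulmxV // !mul1mx !mulmxKV //.
rewrite /c dxmx_u22 u22E !v22E v21E u12E mul_updiag_corner // mul1r mul_corner // mul_corner_updiag //.
rewrite mul_lodiag_updiag mul_updiag_lodiag.
have -> : - B x (j + 1) * (A x j * gam u 0 x j) = gam u 0 x j.
  by transitivity (- (A x j * B x (j + 1)) * gam u 0 x j); [ring|rewrite AB; ring].
apply/matrixP => i k; rewrite !mxE /= /updiag /tridiag.
have [_|ik] := eqVneq (i : nat) k.
  move: (E i.+1 (ltn_ord i)); rewrite /toda_at /=.
  by case: (i : nat) => [|n] /=; case: ifP => _; lra.
case: (i : nat) ik => [|n] /= ik; repeat (case: eqP => ? /=); (ring || (exfalso; lia)).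
Qed.

Lemma commuting_blocksP A B :
  commuting_flows (Mmx N u A) (Vmx N u B) <-> forall x j,
  [/\ phi_block A B x j,
      dxmx (u12 N u A) x j + u12 N u A x j *m v22 N u x j
        = v11 N u x (j + 1) *m u12 N u A x j,
      invmx (u22 N u x (j + 1)) *m v21 N B x j = v21 N B x (j + 1) *m u11 N u x j &
      dxmx (fun y l => invmx (u22 N u y (l + 1))) x j
        + invmx (u22 N u x (j + 1)) *m v22 N u x j
      = v21 N B x (j + 1) *m u12 N u A x j
        + v22 N u x (j + 1) *m invmx (u22 N u x (j + 1))].
Proof.
have dM x j : dxmx (Mmx N u A) x j = block_mx (dxmx (u11 N u) x j) (dxmx (u12 N u A) x j)
    0 (dxmx (fun y l => invmx (u22 N u y (l + 1))) x j).
  rewrite [LHS]dxmx_block; congr block_mx.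
  by apply/matrixP => i k; rewrite [RHS]mxE mxE (_ : (fun _ _ => _) = fun _ _ => 0) ?dx_cst //;
    apply/funext => y; apply/funext => l; rewrite mxE.
rewrite commuting_flowsP; split=> H x j; move: (H x j);
  rewrite dM /Mmx /Vmx /sh !mulmx_block add_block_mx !mul0mx !mulmx0 !add0r !addr0.
  by move=> /eq_block_mx[].
by move=> [-> -> -> ->].
Qed.

(** * Equivalence with the Toda system *)

Definition toda_at0 x j :=
  dx (u 0%N) x j - dx (u 0%N) x (j + 1) = gam u 1 x (j + 1) - gam u 0 x j.

(** The exponential e^(u^1_1 - u^2_2) in the equation for u^0 is the shift of gamma^1, and the
    conditional in [toda_at] absorbs the separate equation for u^N. *)
Lemma toda_systemP : toda_system N u <->
  forall x j, toda_at0 x j /\ forall n, (1 <= n <= N)%N -> toda_at n x j.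
Proof.
rewrite /toda_at0 /toda_at; split=> H x j.
  have [H0 Hn HN] := H x j; split=> // n /andP[n1]; rewrite leq_eqVlt => /predU1P[->|ltn].
    by rewrite ltnn subr0 /gam prednK ?(leq_trans _ hN).
  by rewrite ltn /gam prednK //; apply: Hn; lia.
have [H0 Hn] := H x j; split=> // [n ltn|].
  have := Hn n; rewrite /gam prednK; last by lia.
  by rewrite (_ : (n < N)%N); [move=> -> //; lia|lia].
by have := Hn N; rewrite ltnn subr0 /gam prednK; [move=> -> //; lia|lia].
Qed.

Lemma compatible_toda : compatible N u -> toda_system N u.
Proof.
move=> [A [B [[sA sB] [A0 B0] AB [eA eB] /commuting_blocksP H]]].
have E x j n (ltn : (1 <= n <= N)%N) : toda_at n x j.
  have [/(phi_blockP (AB x j)) phiE _ _ _] := H x j; exact: phiE.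
apply/toda_systemP => x j; split=> [|n]; last exact: E.
(* D B = B holds for every x and may therefore be differentiated. *)
have B1 : dx B x (j + 1) = dx B x j.
  rewrite /dx; congr (derive1 _ x); apply/funext => y; exact: (eB y j).1.
have [Bj dBj] := eB x j; have [_ dBj1] := eB x (j + 1).
move: (E x j 1%N) (E x (j + 1) 1%N); rewrite /toda_at /=.
move=> E1 E2.
have := B0 x j.
(* B and B_x both agree at j and j + 1, so cancelling B in its equation shows that u^0_x + u^1_x +
   gamma^1 is invariant under D. Combined with the equation for u^1 at j, this is the equation for
   u^0. *)
move: dBj1; rewrite B1 {}dBj -[B x (j + 1)]/(sh B x j) Bj => /esym eqB nz.
have {}eqB := mulIf nz eqB; move: eqB E1 E2; rewrite /toda_at0 /gam /sh hN.
by rewrite ltnW // => eqB /(_ isT) E1 /(_ isT) E2; lra.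
Qed.

Lemma toda_compatible : toda_system N u -> compatible N u.
Proof.
move=> /toda_systemP H.
(* The equation for A reads A_x = - g A. *)
pose g x j := dx (u 0%N) x j + dx (u 1%N) x (j + 1) + gam u 0 x j.
have toda1 x j : dx (u 1%N) x j - dx (u 1%N) x (j + 1) = gam u 0 x j - gam u 1 x j.
  by have [_ /(_ 1%N)] := H x j; rewrite /toda_at /= hN => -> //; lia.
(* Since [g] contains u^1 shifted once, D g = g follows from the equation for u^0 at [l] and the one
   for u^1 at [l + 1]. One function of x therefore serves all j. *)
have gj x j : g x j = g x 0.
  apply: (@shift_invariant R (g x)) => l.
  by have [E0 _] := H x l; have E1 := toda1 x (l + 1); rewrite /g; move: E0 E1; rewrite /toda_at0; lra.
have su n : (n <= N)%N -> forall j, smooth1 (u n ^~ j).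
  by move=> len j k x; exact: hu.
have sg : smooth1 (g ^~ 0).
  rewrite /g; apply: smooth1D; first apply: smooth1D.
  - by apply: (@smooth1_derive _ (u 0%N ^~ 0)); apply: su.
  - by apply: (@smooth1_derive _ (u 1%N ^~ (0 + 1))); apply: su; lia.
  - apply: smooth1_exp; apply: (smooth1D (su 0%N isT 0)); apply: smooth1N; apply: su; exact: ltnW.
have [F F'] := continuous_antiderivative (smooth1_continuous sg).
have NF' x : is_derive x (1 : R) (fun y => - F y) (- g x 0) by exact: is_deriveN.
(* With [F] a primitive of [g], these solve A_x = - g A and B_x = g B; being independent of j, they
   satisfy D A = A and D B = B by definition. *)
pose A (x : R) (j : int) := expR (- F x).
pose B (x : R) (j : int) := - expR (F x).
have A' x j : is_derive x (1 : R) (A ^~ j) (- g x 0 * A x j) by exact: is_derive_exp.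
have B' x j : is_derive x (1 : R) (B ^~ j) (g x 0 * B x j).
  by rewrite /B mulrN; apply: is_deriveN; exact: is_derive_exp.
have dA x j : dx A x j = - g x j * A x j by have /is_derive1P[_] := A' x j; rewrite gj.
have dB x j : dx B x j = g x j * B x j by have /is_derive1P[_] := B' x j; rewrite gj.
(* Two different sites are allowed because the (rho, rho) block pairs A at j with B at j + 1. *)
have AB x j l : A x j * B x l = - 1 by rewrite /A /B mulrN -expRD addNr expR0.
(* Smoothness is read off the linear equations, whose coefficients g and - g are smooth. *)
have sB : smooth B.
  move=> j; exact: (smooth1_linear_ode sg (fun x => B' x j)).
have sA : smooth A.
  move=> j; exact: (smooth1_linear_ode (smooth1N sg) (fun x => A' x j)).
exists A, B; split=> //.
- by split=> x j; rewrite ?oppr_eq0 gt_eqF // expR_gt0.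
- split=> x j; split=> //.
    by rewrite dA /g /gam /sh; ring.
  (* The coefficient required for B is u^0_x + u^1_x + gamma^1, which equals [g] by the equation for
     u^1. *)
  rewrite dB; congr (_ * _); have := toda1 x j; rewrite /g /gam /sh; lra.
apply/commuting_blocksP => x j; split.
- by apply/(phi_blockP (AB x j j)); have [] := H x j.
- by apply: (u12_block sA); rewrite dA.
- exact: v21_block.
- by apply: (rho_block (AB x j (j + 1))); have [] := H x (j + 1).
Qed.

End Compatibility.

Theorem lemma5 (R : realType) (N : nat) (hN : (2 <= N)%N)
    (u : nat -> R -> int -> R)
    (hu : forall n : nat, (n <= N)%N -> smooth (u n)) :
  compatible N u <-> toda_system N u.
Proof. by split; [exact: compatible_toda|exact: toda_compatible]. Qed.
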